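(* Let $m,n$ be positive integers with $m\equiv 2\bmod 6$ and $n=ab$, where $a=2^r\cdot 3^s$ with $r,s\geq 1$ and $\gcd(b,6)=1$. Let $f(t)=t^m-t+1$ and let $\gamma_\rho$ be the last non-zero determinantal divisor of the $n\times n$ circulant matrix associated with $f$. If $\gamma_\rho=1$ then $\mathrm{Res}(f,\Phi_d)=\mathrm{Res}(\Phi_6,\Phi_d)$ for all $d\mid n$, $d\neq 6$, and, moreover, $m\equiv 2\bmod 6b$ if $r=1$ and $m\equiv 2\bmod 12b$ if $r\geq 2$.
   Context: The $n\times n$ circulant matrix associated with $f\in\mathbb{Z}[t]$ is the circulant matrix whose first row is $(a_0,\ldots,a_{n-1})$, where $\sum_{i=0}^{n-1}a_it^i$ is the remainder of $f$ modulo $t^n-1$. If its Smith normal form is $\mathrm{diag}_n(s_1,\ldots,s_\rho,0,\ldots,0)$ with $\rho$ its rank, then the last non-zero determinantal divisor is $\gamma_\rho=\prod_{i=1}^\rho s_i$, taken positive. $\mathrm{Res}(\cdot,\cdot)$ denotes the absolute value of the resultant, and $\Phi_d$ denotes the $d$-th cyclotomic polynomial. *)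

(* Defs.v *)
From mathcomp Require Import all_boot all_order all_algebra all_field.

Set Implicit Arguments.
Unset Strict Implicit.
Unset Printing Implicit Defensive.

Import Order.TTheory GRing.Theory Num.Theory.

Local Open Scope ring_scope.

(* Each row is the cyclic shift of the previous one by one place to the right;
   the divisor 'X^n - 1 is monic, so %% is exact Euclidean division. *)
Definition circulant_mx (n : nat) (f : {poly int}) : 'M[int]_n :=
  \matrix_(i < n, j < n) (f %% ('X^n - 1))`_((j + n - i) %% n)%N.

(* diag_n(s_1, ..., s_rho, 0, ..., 0), padded by the default value of s`_i *)
Definition smith_diag_mx (n : nat) (s : seq int) : 'M[int]_n :=
  \matrix_(i < n, j < n) (s`_i *+ (i == j :> nat)).

(* s lists only the nonzero invariant factors, so size s is the rank of A.
   Their signs are left free. *)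
Definition smith_normal_form (n : nat) (A : 'M[int]_n) (s : seq int) : Prop :=
  [/\ (size s <= n)%N, all (fun x => x != 0) s, sorted dvdz s
    & exists L R : 'M[int]_n,
        [/\ L \in unitmx, R \in unitmx & A = L *m smith_diag_mx n s *m R]].

(* The invariant factors are unique up to sign, so this relation determines
   gamma; for the zero matrix gamma is the empty product 1. *)
Definition last_nonzero_det_divisor (n : nat) (A : 'M[int]_n) (gamma : nat) :
    Prop :=
  exists2 s : seq int, smith_normal_form A s & gamma = `|(\prod_(x <- s) x)%R|%N.

Lemma last_nonzero_det_divisor_exists (n : nat) (A : 'M[int]_n) :
  exists gamma : nat, last_nonzero_det_divisor A gamma.
Proof.
suff [s hs] : exists s, smith_normal_form A s.
  by exists `|(\prod_(x <- s) x)%R|%N; exists s.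
have [L uL [R uR [d dd ->]]] := int_Smith_normal_form A.
pose k := find (fun x : int => x == 0) (take n d).
have le_k : (k <= size (take n d))%N by rewrite find_size.
have le_sz : (size (take n d) <= n)%N by rewrite size_take_min geq_minl.
have nz i : (i < k)%N -> (take n d)`_i != 0.
  by move=> lt_ik; have /= := before_find 0 lt_ik => /negbT.
exists (take k (take n d)); split.
- by rewrite size_takel // (leq_trans le_k).
- apply/(all_nthP 0) => i; rewrite size_takel // => lt_ik.
  by rewrite nth_take // nz.
- by do 2!apply: take_sorted.
exists L, R; split=> //; congr (_ *m _ *m _); apply/matrixP=> i j.
rewrite !mxE; congr (_ *+ _).
have <- : (take n d)`_i = d`_i by rewrite nth_take.
have [lt_ik | le_ki] := ltnP i k; first by rewrite [RHS]nth_take.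
rewrite [RHS]nth_default; last by rewrite (size_takel le_k).
have [lt_i | ge_i] := ltnP i (size (take n d)); last by rewrite nth_default.
have dk0 : (take n d)`_k = 0.
  apply/eqP; apply: (nth_find 0 (a := fun x : int => x == 0)).
  by rewrite has_find; apply: leq_ltn_trans lt_i.
have st : sorted dvdz (take n d) by apply: take_sorted.
have tr : transitive dvdz by move=> x y z; apply: dvdz_trans.
have := sorted_leq_nth tr dvdzz 0 st.
move=> /(_ k i (leq_ltn_trans le_ki lt_i) lt_i le_ki).
by rewrite dk0 => h; apply/eqP; rewrite -dvd0z.
Qed.

(* mathcomp's resultant is the determinant of the Sylvester matrix, whose sign
   depends on the ordering convention. *)
Definition absres (p q : {poly int}) : nat := `|resultant p q|%N.

(* Main.v *)
Require Import Defs.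
From mathcomp Require Import all_boot all_order all_algebra all_field.
From mathcomp Require Import all_fingroup zify ring.

Set Implicit Arguments.
Unset Strict Implicit.
Unset Printing Implicit Defensive.

Import Order.TTheory GRing.Theory Num.Theory.

Local Open Scope ring_scope.

(* Write f = Phi_6 F and X^n - 1 = Phi_6 h.  A common root z of f and X^n - 1
   satisfies |z| = |z - 1| = 1, hence is a primitive 6th root of unity, so F
   and h are coprime over Q.  If gamma = 1, the row lattice of the circulant,
   i.e. the ideal (f, X^n - 1) modulo X^n - 1, is saturated; a nonzero multiple
   of Phi_6 lies in it, hence so does Phi_6, and u F + v h = 1 over Z.  For
   d | n, d != 6, Phi_d divides h, so Res(F, Phi_d) = 1.
   For the congruence put c = 2^r b.  Then X^c - 1 divides h, so F is a unit of
   the group ring Z[C_c], and F / conj F, being orthogonal with integer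
   coefficients, is +- a group element.  As Phi_6 is palindromic, f agrees with
   conj f up to such a factor: t^m - t + 1 = +- t^k (t^-m - t^-1 + 1) in Z[C_c].
   Comparing coefficients, with m and c even, gives m = 2 mod c. *)

(** * Resultant with a monic polynomial as a determinant *)

Lemma companion_exists (R : comNzRingType) (q : {poly R}) (e : nat) :
  q \is monic -> size q = e.+2 ->
  exists2 C : 'M[R]_e.+1, horner_mx C q = 0
    & forall i : 'I_e.+1, delta_mx 0 0 *m C ^+ i = delta_mx 0 i :> 'rV_e.+1.
Proof.
move=> mq sq.
(* Both properties are carried together along [(size q).-1 = e.+1]: [horner_mx] needs a successor
   dimension, where matrices form a ring. *)
have : exists2 C : 'M[R]_((size q).-1), char_poly C = q
    & forall i j : 'I_((size q).-1), i.+1 = j ->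
      delta_mx 0 i *m C = delta_mx 0 j :> 'rV_((size q).-1).
  exists (companionmx q); first exact: companionmxK.
  move=> i j ij; have lt_i : (i.+1 < (size q).-1)%N by rewrite ij.
  by rewrite mulmx_delta_companion; congr (delta_mx _ _); apply: val_inj.
have -> : (size q).-1 = e.+1 by rewrite sq.
case=> C CK stepC; exists C; first by rewrite -[X in horner_mx _ X]CK Cayley_Hamilton.
case=> i; elim: i => [|i IHi] lt_i /=.
  by rewrite expr0 mulmx1; congr delta_mx; apply: val_inj.
rewrite exprSr mulmxA (IHi (ltnW lt_i)).
by apply: stepC.
Qed.

Lemma row_horner_mx (R : comNzRingType) (e N : nat) (C : 'M[R]_e.+1)
    (v : 'rV[R]_e.+1) (p : {poly R}) :
  (size p <= N)%N ->
  poly_rV p *m (\matrix_(j < N) (v *m C ^+ j)) = v *m horner_mx C p.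
Proof.
move=> sp; rewrite mulmx_sum_row -{2}(poly_rV_K sp) /rVpoly poly_def.
rewrite rmorph_sum /= mulmx_sumr; apply: eq_bigr => j _.
by rewrite rowK linearZ /= rmorphXn /= horner_mx_X valK /= -scalemxAr.
Qed.

(** Free block sizes allow [dq] to be the successor [e.+1] instead of [(size q).-1]. *)
Definition sylvester_block (R : nzRingType) (dq dp : nat) (p q : {poly R}) :
    'M[R]_(dq + dp) :=
  \matrix_i poly_rV (match split i with
                     | inl k => p * 'X^k
                     | inr k => q * 'X^k
                     end).

Lemma resultant_sylvester_block (R : nzRingType) (dq dp : nat)
    (p q : {poly R}) :
  (size q).-1 = dq -> (size p).-1 = dp ->
  resultant p q = \det (sylvester_block dq dp p q).
Proof.
move=> <- <-; congr (\det _); apply/matrixP=> i j.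
rewrite Sylvester_mxE !mxE.
by case: (split i) => k; rewrite coefMXn ltnNge; case: leqP.
Qed.

(** Column operations of determinant 1 make the Sylvester matrix block triangular, with diagonal
    blocks [horner_mx C p] and a matrix that is unitriangular because [q] is monic. *)
Lemma resultant_horner_mx (R : comNzRingType) (q : {poly R}) (e : nat)
    (C : 'M[R]_e.+1) (p : {poly R}) :
  q \is monic -> size q = e.+2 -> horner_mx C q = 0 ->
  (forall i : 'I_e.+1, delta_mx 0 0 *m C ^+ i = delta_mx 0 i :> 'rV_e.+1) ->
  p != 0 -> resultant p q = \det (horner_mx C p).
Proof.
move=> mq sq Cq0 stepC p0.
have sp : size p = (size p).-1.+1 by rewrite prednK // lt0n size_poly_eq0.
rewrite (@resultant_sylvester_block _ e.+1 (size p).-1) ?sq //.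
set dp := (size p).-1; set S := sylvester_block _ _ _ _.
pose V : 'M[R]_(e.+1 + dp, e.+1) :=
  \matrix_(j < e.+1 + dp) (delta_mx 0 0 *m C ^+ j).
have uV : usubmx V = 1%:M.
  apply/row_matrixP=> i; rewrite row_usubmx rowK /= stepC.
  by apply/rowP=> j; rewrite !mxE eqxx /= eq_sym.
have SV : S *m V = col_mx (horner_mx C p) 0.
  apply/row_matrixP=> i; rewrite row_mul rowK.
  case: (split_ordP i) => k ->; rewrite ?row_usubmx ?row_dsubmx.
    rewrite row_horner_mx; last first.
      rewrite (leq_trans (size_polyMleq _ _)) // size_polyXn sp -/dp addSn addnS /=.
      by have := ltn_ord k; lia.
    rewrite mulrC rmorphM rmorphXn /= horner_mx_X mulmxA stepC.
    by rewrite -rowE; apply/rowP=> j; rewrite !mxE (unsplitK (inl k)).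
  rewrite row_horner_mx; last first.
    rewrite (leq_trans (size_polyMleq _ _)) // size_polyXn sq.
    by have := ltn_ord k; lia.
  rewrite rmorphM /= Cq0 mul0r mulmx0.
  by apply/rowP=> j; rewrite !mxE (unsplitK (inr k)) mxE.
(* Right multiplication by T sends the coefficient vector of a polynomial to
   its residue modulo q followed by its coefficients of degree > e. *)
pose T := row_mx V (col_mx 0 1%:M) : 'M[R]_(e.+1 + dp).
have dT : \det T = 1.
  by rewrite /T -[V]vsubmxK -block_mxEh uV det_lblock !det1 mulr1.
have ST : S *m T = block_mx (horner_mx C p) (ursubmx S) 0 (drsubmx S).
  rewrite /T mul_mx_row SV -[S in X in row_mx _ X]submxK mul_block_col.
  by rewrite !mulmx0 !mulmx1 !add0r block_mxEh.
have dB : \det (drsubmx S) = 1.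
  rewrite det_trig.
    apply: big1 => i _; rewrite !mxE (unsplitK (inr i)) coefMXn /=.
    rewrite ltnNge leq_addl /= addnK.
    by move/monicP: mq; rewrite lead_coefE sq.
  apply/is_trig_mxP => i j lt_ij; rewrite !mxE (unsplitK (inr i)) coefMXn /=.
  case: ltnP => // _; apply: nth_default; rewrite sq; lia.
by have := congr1 determinant ST; rewrite det_mulmx dT mulr1 det_ublock dB mulr1.
Qed.

(** At the companion matrix of [q] the Bezout relation says that [F] becomes invertible over the
    integers, so its determinant is 1 or -1. *)
Lemma absres_monicM (g F u v q : {poly int}) :
  q \is monic -> (1 < size q)%N -> g != 0 -> u * F + v * q = 1 ->
  absres (g * F) q = absres g q.
Proof.
move=> mq sq g0 uv1.
have F0 : F != 0.
  apply: contraTneq sq => F0; move: uv1; rewrite F0 mulr0 add0r => vq1.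
  have : (v * q) \is monic by rewrite vq1 monic1.
  move=> mvq; have mv : v \is monic by rewrite -(monicMr _ mq).
  have := congr1 (fun p : {poly int} => size p) vq1.
  have v0 : v != 0 by rewrite monic_neq0.
  rewrite size_Mmonic // size_poly1.
  by have : (0 < size v)%N by [rewrite lt0n size_poly_eq0]; lia.
have [e se] : exists e, size q = e.+2 by exists (size q).-2; lia.
have [C Cq stepC] := companion_exists mq se.
rewrite /absres !(resultant_horner_mx mq se Cq stepC) ?mulf_neq0 //.
rewrite rmorphM /= det_mulmx abszM.
suff -> : `|\det (horner_mx C F)|%N = 1%N by rewrite muln1.
have := congr1 (fun p => \det (horner_mx C p)) uv1.
rewrite rmorphD !rmorphM /= Cq mulr0 addr0 rmorph1 det1 det_mulmx.
move/(congr1 absz); rewrite abszM /= => /eqP; rewrite muln_eq1 => /andP[_] /eqP.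
by [].
Qed.

(** * Circulants as polynomials in the cyclic shift *)

(** In dimension [N.+2] the indices form the ring of integers modulo [N.+2], so exponents are
    reduced by [k%:R]. *)
Definition shift_mx (N : nat) : 'M[int]_N.+2 := perm_mx (perm (addrI 1)).

Lemma delta_shift_mx N (i : 'I_N.+2) :
  delta_mx 0 i *m shift_mx N = delta_mx 0 (1 + i) :> 'rV_N.+2.
Proof.
by rewrite -rowE; apply/rowP=> j; rewrite !mxE permE eq_sym.
Qed.

Lemma delta_shift_mxX N (i : 'I_N.+2) (k : nat) :
  delta_mx 0 i *m shift_mx N ^+ k = delta_mx 0 (i + k%:R) :> 'rV_N.+2.
Proof.
elim: k => [|k IHk]; first by rewrite mulmx1 addr0.
by rewrite exprSr mulmxA IHk delta_shift_mx addrCA -mulrS.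
Qed.

Lemma shift_mxX_period N : shift_mx N ^+ N.+2 = 1.
Proof.
apply/row_matrixP=> i; rewrite !rowE delta_shift_mxX mulmx1.
suff -> : (N.+2)%:R = 0 :> 'I_N.+2 by rewrite addr0.
by rewrite Zp_nat; apply: val_inj; rewrite /= modnn.
Qed.

Lemma horner_shift_mxXn1 N : horner_mx (shift_mx N) ('X^(N.+2) - 1) = 0.
Proof. by rewrite rmorphB rmorphXn /= horner_mx_X shift_mxX_period rmorph1 subrr. Qed.

Lemma row_horner_shift_mx N (i : 'I_N.+2) (p : {poly int}) :
  (size p <= N.+2)%N ->
  delta_mx 0 i *m horner_mx (shift_mx N) p = \row_j p`_(j - i : 'I_N.+2)%R :> 'rV_N.+2.
Proof.
move=> sp; apply/rowP=> j; rewrite [RHS]mxE.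
have [k0 Dk0] : exists k0 : 'I_N.+2, j - i = k0 by exists (j - i).
rewrite Dk0 -{1}(poly_rV_K sp) /rVpoly poly_def rmorph_sum /= mulmx_sumr summxE.
rewrite (bigD1 k0) //= big1 ?addr0 => [|k].
  rewrite valK linearZ /= rmorphXn /= horner_mx_X -scalemxAr delta_shift_mxX.
  by rewrite natr_Zp -[in i + _]Dk0 [i + _]addrC subrK !mxE !eqxx mulr1.
move=> /negPf nk.
rewrite valK linearZ /= rmorphXn /= horner_mx_X -scalemxAr delta_shift_mxX.
by rewrite natr_Zp !mxE [i + k]addrC -subr_eq Dk0 eq_sym nk mulr0.
Qed.

Lemma monicXnB1 N : ('X^(N.+1) - 1 : {poly int}) \is monic.
Proof. exact: monicXnsubC. Qed.

Lemma horner_shift_mx_mod N (p : {poly int}) :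
  horner_mx (shift_mx N) (p %% ('X^(N.+2) - 1)) = horner_mx (shift_mx N) p.
Proof.
rewrite [in RHS](Pdiv.IdomainMonic.divp_eq (monicXnB1 N.+1) p) rmorphD rmorphM /=.
by rewrite horner_shift_mxXn1 mulr0 add0r.
Qed.

Lemma size_mod_Xn1 N (p : {poly int}) : (size (p %% ('X^(N.+1) - 1))%R <= N.+1)%N.
Proof.
by rewrite -ltnS -(size_XnsubC (1 : int) (ltn0Sn N)) ltn_modp monic_neq0 ?monicXnB1.
Qed.

Lemma circulant_mxE N (f : {poly int}) :
  circulant_mx N.+2 f = horner_mx (shift_mx N) f.
Proof.
rewrite -horner_shift_mx_mod; apply/row_matrixP=> i.
rewrite [RHS]rowE row_horner_shift_mx ?size_mod_Xn1 //.
apply/rowP=> j; rewrite !mxE; congr (_`_ _).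
by rewrite /= modnDmr addnBA // ltnW.
Qed.

(** Row 0 lists the coefficients of the remainder of [p], so it determines [p] modulo
    ['X^(N.+2) - 1]. *)
Lemma horner_shift_mx_eq0 N (p : {poly int}) :
  delta_mx 0 0 *m horner_mx (shift_mx N) p = 0 :> 'rV_N.+2 ->
  exists v, p = v * ('X^(N.+2) - 1).
Proof.
rewrite -horner_shift_mx_mod row_horner_shift_mx ?size_mod_Xn1 // => r0.
exists (p %/ ('X^(N.+2) - 1)).
rewrite [LHS](Pdiv.IdomainMonic.divp_eq (monicXnB1 N.+1) p).
rewrite (_ : p %% _ = 0) ?addr0 //; apply/polyP=> k; rewrite coef0.
have [lt_k|le_k] := ltnP k N.+2; last first.
  by rewrite nth_default // (leq_trans (size_mod_Xn1 _ _)).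
by have /rowP/(_ (Ordinal lt_k)) := r0; rewrite !mxE subr0.
Qed.

Lemma row_horner_shift_mxE N (v : 'rV[int]_N.+2) :
  v = delta_mx 0 0 *m horner_mx (shift_mx N) (rVpoly v).
Proof.
rewrite row_horner_shift_mx ?size_poly //; apply/rowP=> j.
by rewrite mxE subr0 coef_rVpoly_ord.
Qed.

(** * Saturation of the row lattice when the determinantal divisor is 1 *)

(** All invariant factors are 1 or -1, so the Smith form satisfies D^3 = D and is its own
    generalized inverse. *)
Lemma smith_prod1_ginv (N : nat) (A : 'M[int]_N) :
  last_nonzero_det_divisor A 1 -> exists X, A *m X *m A = A.
Proof.
case=> s [ss nzs _ [L [R [uL uR ->]]]] ps.
(* The default value 0 past [size s] satisfies this cubic identity as well. *)
have s1 i : s`_i * s`_i * s`_i = s`_i.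
  have [lt_i|le_i] := ltnP i (size s); last by rewrite nth_default ?mulr0.
  have us : all (fun x => `|x|%N == 1%N) s.
    move: ps {ss nzs lt_i}; elim: s => //= x s IHs.
    rewrite big_cons abszM => /esym/eqP; rewrite muln_eq1 => /andP[-> /eqP p1].
    by rewrite IHs.
  have := all_nthP 0 us i lt_i; case: (s`_i) => [[|[|]]|[]] //.
exists (invmx R *m smith_diag_mx N s *m invmx L).
set D := smith_diag_mx N s.
have DDD : D *m D *m D = D.
  have DE : D = diag_mx (\row_(i < N) s`_i).
    by apply/matrixP=> i j; rewrite !mxE.
  rewrite DE !mulmx_diag; congr diag_mx.
  by apply/rowP=> j; rewrite !mxE s1.
by rewrite !mulmxA mulmxKV // mulmxK // -[in RHS]DDD !mulmxA.
Qed.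

(* A generalized inverse makes the row lattice of the circulant saturated. *)
Lemma det_divisor1_ideal (N k : nat) (f g u h : {poly int}) :
  last_nonzero_det_divisor (circulant_mx N.+2 f) 1 ->
  k != 0%N -> g *+ k = u * f + h * ('X^(N.+2) - 1) ->
  exists w v, g = w * f + v * ('X^(N.+2) - 1).
Proof.
rewrite circulant_mxE => /smith_prod1_ginv[X AXA] k0 gk.
set H := horner_mx (shift_mx N) in AXA.
have {}AXA : H f * X * H f = H f by exact: AXA.
have Hgk : H g *+ k = H u * H f.
  by rewrite -rmorphMn gk rmorphD !rmorphM /= horner_shift_mxXn1 mulr0 addr0.
(* After multiplication by [k] this follows from [AXA], as [H g *+ k] is a left multiple of [H f];
   integers are torsion-free, so [k] cancels. *)
have gXA : H g * X * H f = H g.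
  apply/eqP; rewrite -subr_eq0; apply/eqP/matrixP=> i j; apply/eqP; rewrite mxE.
  have : (H g * X * H f - H g) *+ k = 0.
    by rewrite mulrnBl -!mulrnAl Hgk -!mulrA [H f * _]mulrA AXA subrr.
  move=> /matrixP/(_ i j); rewrite mulmxnE !mxE => /eqP.
  by rewrite mulrn_eq0 (negPf k0).
(* Row 0 of [H g * X], read as a polynomial, is the cofactor of [f]. *)
pose y : 'rV_N.+2 := delta_mx 0 0 *m (H g * X).
have [v hv] : exists v, g - rVpoly y * f = v * ('X^(N.+2) - 1).
  apply: horner_shift_mx_eq0; rewrite rmorphB rmorphM /= mulmxBr.
  rewrite mulmxA -row_horner_shift_mxE /y -/H -[in X in X - _]gXA.
  by rewrite -mulmxA; apply: subrr.
by exists (rVpoly y), v; rewrite -hv addrC subrK.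
Qed.

(** * Units of the group ring and their conjugates *)

(** The squared entries of the row are nonnegative integers with sum 1. *)
Lemma int_orthogonal_row (n : nat) (W : 'M[int]_n) (i : 'I_n) :
  W *m W^T = 1%:M ->
  exists (e : bool) (j : 'I_n), row i W = (-1) ^+ e *: delta_mx 0 j.
Proof.
move=> /matrixP/(_ i i); rewrite !mxE eqxx => s1.
have {}s1 : \sum_j W i j ^+ 2 = 1.
  by rewrite -[RHS]s1; apply: eq_bigr => j _; rewrite mxE expr2.
have [j Wj] : exists j, W i j != 0.
  apply/existsP; apply: contraT; rewrite negb_exists => /forallP W0.
  move: s1; rewrite big1 // => j _.
  by have := W0 j; rewrite negbK => /eqP ->; rewrite expr0n.
have ge0 k : 0 <= W i k ^+ 2 by rewrite sqr_ge0.
have Wj1 : 1 <= W i j ^+ 2 by rewrite -gtz0_ge1 exprn_even_gt0.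
move: s1; rewrite (bigD1 j) //= => s1.
have rest0 : \sum_(k | k != j) W i k ^+ 2 = 0.
  apply/eqP; rewrite eq_le sumr_ge0 // andbT.
  by rewrite -(lerD2l (W i j ^+ 2)) s1 addr0.
move: s1; rewrite rest0 addr0 => Wj2.
exists (W i j < 0), j; apply/rowP=> k; rewrite !mxE eqxx /=.
have [->|nkj] := eqVneq k j.
  move/eqP: Wj2; rewrite sqrf_eq1 mulr1 => /orP[] /eqP -> //.
move/eqP: rest0; rewrite psumr_eq0 => [|//] /allP/(_ k (mem_index_enum _)).
by rewrite nkj /= sqrf_eq0 mulr0 => /eqP.
Qed.

(** Modulo ['X^(N.+2) - 1] the power ['X^(N.+1)] is inverse to ['X], so this is the group ring
    involution; on circulants it is transposition. *)
Definition conj_poly (N : nat) (p : {poly int}) : {poly int} := p \Po 'X^(N.+1).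

Lemma shift_mx_tr N : (shift_mx N)^T = shift_mx N ^+ N.+1.
Proof.
have PT : shift_mx N *m (shift_mx N)^T = 1%:M.
  by rewrite tr_perm_mx -perm_mxM mulgV perm_mx1.
by rewrite -[LHS]mul1r -(shift_mxX_period N) exprSr -mulrA [_ * _^T]PT mulr1.
Qed.

Lemma horner_shift_mx_tr N (p : {poly int}) :
  (horner_mx (shift_mx N) p)^T = horner_mx (shift_mx N) (conj_poly N p).
Proof.
rewrite /conj_poly.
elim/poly_ind: p => [|p c IHp]; first by rewrite comp_poly0 !rmorph0 trmx0.
rewrite comp_poly_MXaddC !rmorphD !rmorphM /= !horner_mx_C rmorphXn /= horner_mx_X.
rewrite linearD /= tr_scalar_mx trmx_mul IHp shift_mx_tr; congr (_ + _).
have -> : shift_mx N ^+ N.+1 = horner_mx (shift_mx N) 'X^(N.+1).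
  by rewrite rmorphXn /= horner_mx_X.
by rewrite -[LHS]rmorphM mulrC rmorphM.
Qed.

(* W := F / conj F is a unit with W * conj W = 1, so its coefficient vector has
   Euclidean norm 1. *)
Lemma unit_circulant_conj N (F u v : {poly int}) :
  u * F + v * ('X^(N.+2) - 1) = 1 ->
  exists (e : bool) (k : 'I_N.+2), forall g : {poly int},
    delta_mx 0 0 *m horner_mx (shift_mx N) (g * F)
      = (-1) ^+ e *: (delta_mx 0 k *m horner_mx (shift_mx N) (g * conj_poly N F))
      :> 'rV_N.+2.
Proof.
move=> uv1; set H := horner_mx (shift_mx N).
have uF : H u * H F = 1.
  have := congr1 H uv1; rewrite /H rmorphD !rmorphM rmorph1 /=.
  by rewrite horner_shift_mxXn1 mulr0 addr0.
have uFb : H (conj_poly N u) * H (conj_poly N F) = 1.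
  rewrite /H -!horner_shift_mx_tr -[_ * _]trmx_mul.
  by rewrite -[_ *m _]/(_ * _) -rmorphM mulrC rmorphM uF trmx1.
(* The inverse of conj F is conj u. *)
pose W := H (F * conj_poly N u).
have WW : W *m W^T = 1%:M.
  rewrite /W {1 2}/H rmorphM /= -/H.
  have tr p : (H (conj_poly N p))^T = H p.
    by rewrite /H -horner_shift_mx_tr trmxK.
  rewrite -[H F * _]/(_ *m _) trmx_mul tr {3}/H horner_shift_mx_tr -/H.
  change (H F * H (conj_poly N u) * (H u * H (conj_poly N F)) = 1).
  transitivity (H u * H F * (H (conj_poly N u) * H (conj_poly N F))).
    by rewrite /H -!rmorphM; congr horner_mx; ring.
  by rewrite uF mul1r uFb.
have [e [k Wk]] := int_orthogonal_row 0 WW.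
exists e, k => g; rewrite /H !rmorphM /= -/H.
have WF : H F = W * H (conj_poly N F).
  by rewrite /W /H rmorphM /= -/H -mulrA uFb mulr1.
have -> : H g * H F = W * (H g * H (conj_poly N F)).
  by rewrite WF /W /H -!rmorphM; congr horner_mx; ring.
by rewrite mulmxA -rowE Wk -scalemxAl.
Qed.

(** * Splitting off the sixth cyclotomic polynomial *)

(** The product formula for 1, 2, 3, 6 gives (X^2 - 1)(X^3 - 1) Phi_6 = (X - 1)(X^6 - 1). *)
Lemma Cyclotomic6 : 'Phi_6 = 'X^2 - 'X + 1.
Proof.
have P n : (0 < n)%N -> \prod_(d <- divisors n) 'Phi_d = 'X^n - 1.
  exact: prod_Cyclotomic.
have := P 1%N isT; have := P 2%N isT; have := P 3%N isT; have := P 6%N isT.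
rewrite !big_cons !big_nil !mulr1 => P6 P3 P2 P1.
have nz n : (0 < n)%N -> 'X^n - 1 != 0 :> {poly int}.
  by move=> n0; rewrite monic_neq0 // monicXnsubC.
apply: (mulfI (mulf_neq0 (nz 2%N isT) (nz 3%N isT))).
rewrite -{1}P3 -{1}P2 -[LHS](_ : 'Phi_1 * ('Phi_1 * ('Phi_2 * ('Phi_3 * 'Phi_6))) = _).
  by rewrite P6 P1; ring.
by ring.
Qed.

Lemma trinomial_factor (m : nat) :
  (m = 2 %[mod 6])%N -> exists F : {poly int}, 'X^m - 'X + 1 = 'Phi_6 * F.
Proof.
move=> hm; rewrite (divn_eq m 6) hm Cyclotomic6.
(* With q = [m %/ 6], the trinomial is X^2 (X^(6q) - 1) + Phi_6, and X^6 - 1 = Phi_6 (X + 1)(X^3 -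
   1). *)
exists ('X^2 * (('X + 1) * ('X^3 - 1) * \sum_(i < m %/ 6) ('X^6) ^+ i) + 1).
set S := \sum_(i < _) _.
transitivity ('X^2 * (('X^6 - 1) * S) + ('X^2 - 'X + 1)); last by ring.
rewrite -subrX1 -exprM mulrBr mulr1 -exprD [(6 * _)%N]mulnC [(2 + _)%N]addnC.
by rewrite (_ : 2 %% 6 = 2)%N //; ring.
Qed.

(** Both [z] and [z - 1 = z ^+ m] have modulus 1; expanding the norm of [z - 1] shows that [z] has
    trace 1 and norm 1. *)
Lemma root_trinomial_root_unity (m n : nat) (z : algC) :
  (0 < n)%N -> z ^+ n = 1 -> z ^+ m - z + 1 = 0 -> z ^+ 2 - z + 1 = 0.
Proof.
move=> n0 zn1 fz.
have nz : `|z| = 1.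
  apply/eqP; rewrite -(@pexpr_eq1 _ _ n) //; by rewrite -normrX zn1 normr1.
have nz1 : `|z - 1| = 1.
  have -> : z - 1 = z ^+ m by rewrite -[LHS]addr0 -fz; ring.
  by rewrite normrX nz expr1n.
have e1 : z * z^* = 1 by rewrite -normCK nz expr1n.
have e2 : (z - 1) * (z^* - 1) = 1.
  have -> : z^* - 1 = (z - 1)^* by rewrite rmorphB rmorph1.
  by rewrite -normCK nz1 expr1n.
have e3 : z + z^* = 1.
  apply/eqP; rewrite -subr_eq0; apply/eqP.
  transitivity (z * z^* - (z - 1) * (z^* - 1)); first by ring.
  by rewrite e1 e2 subrr.
transitivity (z ^+ 2 - z * (z + z^*) + z * z^*); first by rewrite e3 e1 mulr1.
by ring.
Qed.

(** A common root of [F] and [h] would also be a root of Phi_6, hence a double root of the separable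
    polynomial X^n - 1. *)
Lemma coprime_cofactors (m n : nat) (F h : {poly int}) :
  (0 < n)%N -> 'X^m - 'X + 1 = 'Phi_6 * F -> 'X^n - 1 = 'Phi_6 * h ->
  coprimep F h.
Proof.
move=> n0 fF nh; rewrite /coprimep; apply: contraT => gcd1.
pose t := map_poly (intr : int -> algC).
have h0 : h != 0.
  by apply: contra_eq_neq nh => ->; rewrite mulr0 monic_neq0 // monicXnsubC.
have [z rz] : exists z, root (t (gcdp F h)) z.
  apply/closed_rootP; rewrite size_map_inj_poly ?rmorph0 //; exact: intr_inj.
(* Divisibility over [int] is pseudo-divisibility, up to a nonzero constant [c] that cancels in
   [algC]. *)
have dz p : gcdp F h %| p -> (t p).[z] = 0.
  move=> /Pdiv.Idomain.dvdpP[[c q] /= c0 cq].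
  have := congr1 (fun p => (t p).[z]) cq.
  rewrite /t map_polyZ rmorphM hornerZ hornerM -/t /= (rootP rz) mulr0 => /eqP.
  by rewrite mulf_eq0 intr_eq0 (negPf c0) => /eqP.
have Fz := dz F (dvdp_gcdl _ _); have hz := dz h (dvdp_gcdr _ _).
have ht : 'X^n - 1 = t 'Phi_6 * t h.
  by rewrite -rmorphM -nh rmorphB rmorph1 /= map_polyXn.
have zn1 : z ^+ n = 1.
  have := congr1 (horner^~ z) ht; rewrite !hornerE hz mulr0 => /eqP.
  by rewrite subr_eq0 => /eqP.
have tz : z ^+ m - z + 1 = 0.
  have := congr1 (fun p => (t p).[z]) fF.
  rewrite /t !(rmorphM, rmorphB, rmorphD, rmorph1) /= map_polyXn map_polyX.
  by rewrite -/t !hornerE Fz mulr0.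
have phz : (t 'Phi_6).[z] = 0.
  rewrite Cyclotomic6 /t rmorphD rmorphB rmorph1 /= map_polyXn map_polyX.
  by rewrite !hornerE (root_trinomial_root_unity n0 zn1 tz).
have := congr1 (fun p => p^`().[z]) ht.
rewrite derivM !hornerE hz phz mulr0 mul0r addr0.
rewrite derivB derivXn derivC subr0 hornerMn hornerXn => /eqP.
rewrite mulrn_eq0 (gtn_eqF n0) /= expf_eq0 => /andP[_ /eqP z0].
by have := zn1; rewrite z0 expr0n (gtn_eqF n0) => /eqP; rewrite eq_sym oner_eq0.
Qed.

(** Over [int], coprimality yields only a nonzero constant; the factor [Num.sg c] turns it into a
    natural number. *)
Lemma coprimep_int_Bezout (p q : {poly int}) :
  coprimep p q -> exists k u v, k != 0%N /\ u * p + v * q = k%:R.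
Proof.
case/Bezout_coprimepP=> -[u v] /= /eqp_size; rewrite size_poly1.
move=> /eqP/size_poly1P[c c0 uv].
exists `|c|%N, ((Num.sg c)%:P * u), ((Num.sg c)%:P * v); split; first by rewrite absz_eq0.
rewrite -!mulrA -mulrDr uv -polyCM -normrEsg -abszE.
by rewrite -polyC_natr natz.
Qed.

(** Take for [h] the product of the other cyclotomic factors; when 3 does not divide [c], neither
    does 6, so every factor of X^c - 1 survives in [h]. *)
Lemma Xn1_cofactor6 (n : nat) :
  (0 < n)%N -> (6 %| n)%N ->
  exists h : {poly int}, [/\ 'X^n - 1 = 'Phi_6 * h,
    forall d, (d %| n)%N -> d != 6%N -> exists h', h = h' * 'Phi_d
  & forall c, (c %| n)%N -> ~~ (3 %| c)%N -> exists h', h = h' * ('X^c - 1)].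
Proof.
move=> n0 n6; have [uDn _ inDn] := divisors_correct n0.
exists (\prod_(d <- divisors n | d != 6%N) 'Phi_d); split.
- by rewrite -prod_Cyclotomic // (bigD1_seq 6%N) ?inDn.
- move=> d dn d6; rewrite (big_rem d) ?inDn //= d6.
  by exists (\prod_(i <- rem d (divisors n) | i != 6%N) 'Phi_i); rewrite mulrC.
move=> c cn c3; rewrite (bigID (fun d => d %| c)%N) /=.
have c0 : (0 < c)%N by rewrite (dvdn_gt0 n0).
have [uDc _ inDc] := divisors_correct c0.
exists (\prod_(d <- divisors n | (d != 6%N) && ~~ (d %| c)%N) 'Phi_d).
rewrite mulrC -prod_Cyclotomic //; congr (_ * _).
rewrite -big_filter; apply: perm_big; apply: uniq_perm => // [|d].
  by rewrite filter_uniq.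
rewrite mem_filter inDn inDc; apply/andP/idP => [[/andP[]] //|dc].
rewrite dc (dvdn_trans dc cn) andbT; split=> //.
by apply: contra c3 => /eqP d6; rewrite d6 in dc; apply: dvdn_trans dc.
Qed.

(** * The congruence from comparing coefficients in the group ring *)

Lemma trinomial_circulant_unit (N m : nat) (F u v : {poly int}) :
  'X^m - 'X + 1 = ('X^2 - 'X + 1) * F -> u * F + v * ('X^(N.+2) - 1) = 1 ->
  ~~ odd m -> ~~ odd N -> (m = 2 %[mod N.+2])%N.
Proof.
move=> fF uv1 m2 N2; case: (posnP N) => [->|N0].
  by rewrite !modn2 (negPf m2).
have [e [k Wk]] := unit_circulant_conj uv1.
have := Wk ('X^2 - 'X + 1); rewrite -fF.
have PN j : shift_mx N ^+ (j * N.+2) = 1.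
  by rewrite mulnC exprM shift_mxX_period expr1n.
have H3 i j l : horner_mx (shift_mx N) ('X^i - 'X^j + 'X^l)
    = shift_mx N ^+ i - shift_mx N ^+ j + shift_mx N ^+ l.
  by rewrite rmorphD rmorphB !rmorphXn /= horner_mx_X.
have conj3 i : 'X^2 * (('X^i - 'X + 1) \Po 'X^(N.+1))
    = 'X^(2 + N.+1 * i) - 'X^(2 + N.+1) + 'X^2 :> {poly int}.
  rewrite comp_polyD comp_polyB comp_Xn_poly comp_polyX comp_polyC -exprM.
  by rewrite !exprD; ring.
(* Phi_6 is palindromic of degree 2. *)
have palin : horner_mx (shift_mx N) ('X^2 * conj_poly N ('X^2 - 'X + 1))
    = horner_mx (shift_mx N) ('X^2 - 'X + 1).
  rewrite conj3 -['X in RHS]expr1 -[1 in RHS](expr0 'X) !H3.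
  rewrite (_ : 2 + N.+1 * 2 = 2 * N.+2)%N; last by lia.
  rewrite PN (_ : 2 + N.+1 = 1 + 1 * N.+2)%N; last by lia.
  by rewrite exprD PN mulr1 expr0 [LHS]addrC [LHS]addrA [RHS]addrAC.
have -> : horner_mx (shift_mx N) (('X^2 - 'X + 1) * conj_poly N F)
    = horner_mx (shift_mx N) ('X^2 * conj_poly N ('X^m - 'X + 1)).
  by rewrite rmorphM /= -palin -rmorphM -mulrA /conj_poly -comp_polyM -fF.
rewrite conj3 -['X in LHS]expr1 -[1 in LHS](expr0 'X) !H3.
rewrite !(mulmxDr, mulmxN) !delta_shift_mxX !add0r mulr0n => E.
(* Summing coordinates gives 1 on the left and [(-1) ^+ e] on the right, so the sign is positive. *)
move/(congr1 (mulmx^~ (const_mx 1 : 'cV_N.+2))): (E).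
have d1 (i : 'I_N.+2) : delta_mx 0 i *m (const_mx 1 : 'cV[int]_N.+2) = 1%:M.
  by rewrite -rowE row_const; apply/matrixP=> a b; rewrite !mxE !ord1 eqxx.
rewrite /= -scalemxAl !(mulmxDl, mulNmx) !d1 subrr add0r.
move/matrixP/(_ 0 0); rewrite !mxE /= mulr1 => e1; move: E; rewrite -e1 scale1r {e e1 Wk}.
have eqR x y : (x%:R == y%:R :> 'I_N.+2) = (x == y %[mod N.+2])%N.
  by rewrite -val_eqE /= !Zp_nat.
have N1R : N.+1%:R = -1 :> 'I_N.+2.
  by apply/eqP; rewrite -addr_eq0 natr1 (eqR _ 0%N) modnn.
have R1 : (2 + N.+1)%:R = 1 :> 'I_N.+2 by rewrite natrD N1R addrK.
have m1 : (m%:R == 1 :> 'I_N.+2) = false.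
  apply/negbTE; rewrite (eqR _ 1%N); apply: contra m2 => /eqP m1.
  rewrite (divn_eq m N.+2) m1 modn_small // oddD oddM /= negbK (negPf N2).
  by rewrite andbF.
move=> E; have {}E j : ((j == m%:R)%:R - (j == 1)%:R + (j == 0)%:R : int)
    = (j == k + (2 + N.+1 * m)%:R)%:R - (j == k + (2 + N.+1)%:R)%:R
      + (j == k + 2)%:R.
  by have /matrixP/(_ 0 j) := E; rewrite !mxE eqxx.
(* At index 1 the left side is -1, because [m] is neither 1 nor odd modulo the even [N.+2]; only the
   negative term on the right can match it. *)
have k0 : k = 0.
  have := E 1; rewrite eqxx oner_eq0 eq_sym m1.
  rewrite R1; case: (1 =P k + 1) => [k1 _|_]; last by do 2!case: eqP.
  by apply: (addIr 1); rewrite add0r -k1.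
(* At index 0 the left side is at least 1, while 0 differs from 2 since [N] is positive; so the term
   at 2 - m must contribute. *)
have := E 0; rewrite k0 R1 !add0r eqxx.
have -> : (0 == 2 :> 'I_N.+2) = false.
  by rewrite (eqR 0%N 2%N) mod0n modn_small ?ltnS.
rewrite -[0 == 1]/false.
case: (0 =P (2 + N.+1 * m)%:R) => [a0 _|_]; last by case: eqP.
apply/eqP; rewrite -eqR.
move/esym: a0; rewrite natrD natrM N1R mulN1r => /eqP.
by rewrite subr_eq0 eq_sym.
Qed.

(** * Chinese remaindering and conclusion *)

Lemma modn_coprime_mul (x y c d : nat) :
  coprime c d -> (x = y %[mod c])%N -> (x = y %[mod d])%N ->
  (x = y %[mod c * d])%N.
Proof. by move=> co xc xd; apply/eqP; rewrite chinese_remainder // xc xd !eqxx. Qed.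

Lemma modn_dvd_eq (x y c d : nat) :
  (d %| c)%N -> (x = y %[mod c])%N -> (x = y %[mod d])%N.
Proof. by move=> dc xy; rewrite -(modn_dvdm x dc) xy modn_dvdm. Qed.

Theorem theorem5p6 (m n a b r s gamma : nat) (f : {poly int})
    (hm0 : (0 < m)%N) (hn0 : (0 < n)%N)
    (hm : (m = 2 %[mod 6])%N)
    (hn : n = (a * b)%N)
    (ha : a = (2 ^ r * 3 ^ s)%N)
    (hr : (1 <= r)%N) (hs : (1 <= s)%N)
    (hb : coprime b 6)
    (hf : f = 'X^m - 'X + 1)
    (hgamma : last_nonzero_det_divisor (circulant_mx n f) gamma) :
  gamma = 1%N ->
  (forall d : nat, (d %| n)%N -> d != 6%N ->
     absres f 'Phi_d = absres 'Phi_6 'Phi_d) /\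
  (r = 1%N -> (m = 2 %[mod 6 * b])%N) /\
  ((2 <= r)%N -> (m = 2 %[mod 12 * b])%N).
Proof.
move=> g1; rewrite g1 in hgamma.
have [F fF] := trinomial_factor hm; rewrite -hf in fF.
have n6 : (6 %| n)%N.
  by rewrite hn ha dvdn_mulr // (@dvdn_mul 2 3) // dvdn_exp.
have [h [nh hPhi hX]] := Xn1_cofactor6 hn0 n6.
have [N nN] : exists N, n = N.+2.
  by exists n.-2; have := dvdn_leq hn0 n6; lia.
have Phi0 : 'Phi_6 != 0 by rewrite monic_neq0 // Cyclotomic_monic.
have [w [v wv1]] : exists w v, w * F + v * h = 1.
  have [|k [u [v [k0 uv]]]] := @coprimep_int_Bezout F h.
    by apply: (@coprime_cofactors m n) => //; rewrite -hf.
  (* Multiplying the relation [uv] by Phi_6 puts ['Phi_6 *+ k] in the ideal of [f] and X^n - 1;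
     saturation removes [k], and Phi_6 is then cancelled. *)
  rewrite nN in hgamma nh.
  have [|w [v' E]] := @det_divisor1_ideal N k f 'Phi_6 u v hgamma k0.
    by rewrite fF nh -mulr_natr -uv; ring.
  exists w, v'; apply: (mulfI Phi0).
  by rewrite mulr1 [RHS]E fF nh; ring.
split=> [d dn d6|].
  have d0 : (0 < d)%N := dvdn_gt0 hn0 dn.
  have [h' hh'] := hPhi d dn d6.
  rewrite fF; apply: (@absres_monicM _ _ w (v * h')) => //.
  - exact: Cyclotomic_monic.
  - by rewrite size_Cyclotomic ltnS totient_gt0.
  - by rewrite -mulrA -hh'.
have b0 : (0 < b)%N by move: hn0; rewrite hn muln_gt0 => /andP[].
have /andP[b2 b3] : coprime b 2 && coprime b 3 by rewrite -coprimeMr.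
have m2 : ~~ odd m.
  by have := @modn_dvd_eq m 2 6 2 isT hm; rewrite !modn2; case: (odd m).
have m3 : (m = 2 %[mod 3])%N := @modn_dvd_eq m 2 6 3 isT hm.
have mc : (m = 2 %[mod 2 ^ r * b])%N.
  have cn : (2 ^ r * b %| n)%N by rewrite hn ha mulnAC dvdn_mulr.
  have c3 : ~~ (3 %| 2 ^ r * b)%N.
    by rewrite -prime_coprime // coprime_sym coprimeMl b3 coprimeXl.
  have ce : ~~ odd (2 ^ r * b) by rewrite oddM oddX -(prednK hr).
  have c0 : (0 < 2 ^ r * b)%N by rewrite muln_gt0 expn_gt0 b0.
  have [h' hh'] := hX _ cn c3.
  move: (2 ^ r * b)%N ce c0 hh' => [|[|c]] // ce _ hh'.
  apply: (@trinomial_circulant_unit c m F w (v * h')) => //.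
  - by rewrite -hf fF Cyclotomic6.
  - by rewrite -mulrA -hh'.
  - by move: ce; rewrite /= negbK.
have b3' : coprime 3 b by rewrite coprime_sym.
(* The congruence modulo 3 is combined with [mc], whose modulus is [2 * b] if [r] is 1 and a
   multiple of [4 * b] otherwise. *)
split=> hr'.
  rewrite (_ : 6 * b = 3 * (2 * b))%N; last by lia.
  apply: modn_coprime_mul; rewrite ?coprimeMr ?b3' //.
  by rewrite hr' in mc.
rewrite (_ : 12 * b = 3 * (4 * b))%N; last by lia.
apply: modn_coprime_mul; rewrite ?coprimeMr ?b3' //.
by apply: modn_dvd_eq mc; rewrite dvdn_pmul2r // (@dvdn_exp2l 2 2).
Qed.
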